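(* Let $\sigma_1$ be a random variable uniformly distributed on $\{0,1,2\}$, so that $\mathbb{P}_0(\sigma_1=k)=1/3$ for each $k\in\{0,1,2\}$. Let $\zeta_0(\beta):=\log \mathbb{E}_0\left(\exp(\beta\sigma_1)\right)$ for $\beta\in\mathbb{R}$, and let $$L_0(\alpha):=\sup_{\beta\in\mathbb{R}}\left\{\alpha\beta-\zeta_0(\beta)\right\}.$$ Then for every $\alpha\in(0,2)$, $$L_0(\alpha)=\log 3+\alpha\log\left(\frac{(\alpha-1)+\sqrt{1+6\alpha-3\alpha^2}}{2(2-\alpha)}\right)-\log\left(\frac{(7-3\alpha)+\sqrt{1+6\alpha-3\alpha^2}}{2(2-\alpha)^2}\right).$$
   Context: Here $\mathbb{P}_0$ and $\mathbb{E}_0$ denote probability and expectation for the uniform distribution on $\{0,1,2\}$, and $\log$ is the natural logarithm. The function $L_0$ is called the Mogulskii Lagrangian of the i.i.d. process whose increments are uniform on $\{0,1,2\}$ (the case $K=2$ of increments uniform on $\{0,1,\dots,K\}$). It is the Legendre transform of the logarithmic moment-generating function $\zeta_0$ of one increment. *)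

(* Defs.v *)
From HB Require Import structures.
From mathcomp Require Import all_boot all_order all_algebra.
From mathcomp Require Import all_classical all_reals all_analysis.

Set Implicit Arguments.
Unset Strict Implicit.
Unset Printing Implicit Defensive.

Import Order.TTheory GRing.Theory Num.Theory.
Import numFieldNormedType.Exports.

Local Open Scope classical_set_scope.
Local Open Scope ring_scope.
Local Open Scope ereal_scope.

Definition log_mgf (d : measure_display) (T : measurableType d) (R : realType)
    (P : probability T R) (X : {RV P >-> R}) (beta : R) : \bar R :=
  lne ('M_P X beta).

(* The supremum is taken in \bar R: it needs no boundedness side condition,
   and [(alpha * beta)%:E - _] is never of the form +oo - +oo. *)
Definition legendre (R : realType) (f : R -> \bar R) (alpha : R) : \bar R :=
  ereal_sup [set (alpha * beta)%:E - f beta | beta in [set: R]].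

Definition mogulskii_lagrangian (d : measure_display) (T : measurableType d)
    (R : realType) (P : probability T R) (X : {RV P >-> R}) : R -> \bar R :=
  legendre (log_mgf X).

(* Main.v *)
Require Import Defs.
From HB Require Import structures.
From mathcomp Require Import all_boot all_order all_algebra.
From mathcomp Require Import all_classical all_reals all_analysis.
From mathcomp Require Import measurable_realfun.
From mathcomp Require Import ring lra.

Set Implicit Arguments.
Unset Strict Implicit.
Unset Printing Implicit Defensive.

Import Order.TTheory GRing.Theory Num.Theory.
Import numFieldNormedType.Exports.

Local Open Scope classical_set_scope.
Local Open Scope ring_scope.

(** The supremum defining the Lagrangian is attained, and the maximizer solves
    a quadratic equation.  Write the moment-generating function as a finite
    exponential sum [M beta], here [(1 + t + t ^+ 2) / 3] with [t = expR beta]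
    ([mmt_gen_fun_finite_support]).  The concave function
    [alpha * beta - ln (M beta)] is maximal wherever its derivative vanishes,
    that is, wherever the exponentially tilted law has mean [alpha]
    ([exp_sum_tilt_max]).  For the uniform law this condition reads
    [t + 2 * t ^+ 2 = alpha * (1 + t + t ^+ 2)], whose only positive root is
    [tilt_root alpha]; the equation also reduces [1 + t + t ^+ 2] to the
    quotient in the second logarithm ([tilt_root_partition]). *)

(** * Exponential moments of a finitely supported random variable *)

(** The support condition is stated on total mass only: the event where [X]
    takes no value in [s] may be nonempty, but it is negligible. *)
Lemma expectation_finite_support (R : realType) (d : measure_display)
    (T : measurableType d) (P : probability T R) (X : {RV P >-> R})
    (s : seq R) (f : R -> R) :
  uniq s -> measurable_fun setT f -> (forall x, 0 <= f x) ->
  (\sum_(x <- s) P (X @^-1` [set x]) = 1)%E ->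
  ('E_P[f \o X] = \sum_(x <- s) (f x)%:E * P (X @^-1` [set x]))%E.
Proof.
move=> us mf f0 mass1.
pose F x := X @^-1` [set x]; pose D := \big[setU/set0]_(x <- s) F x.
have mF x : measurable (F x) by exact: measurable_funPTI.
have mD : measurable D by exact: bigsetU_measurable.
have tF : trivIset [set` s] F.
  exact: trivIset_preimage1.
have mfX : measurable_fun setT (EFin \o (f \o X)).
  by apply/measurable_EFinP/measurableT_comp.
have PD : P D = 1%E.
  rewrite -[P D]mul1e -integral_cst// ge0_integral_bigsetU// -[RHS]mass1.
  by apply: eq_bigr => x _; rewrite integral_cst// mul1e.
have PDC : P (~` D) = 0%E by rewrite probability_setC// PD subee.
rewrite unlock (@ge0_negligible_integral _ _ _ _ setT (~` D))//=; last 2 first.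
- exact: measurableC.
- by move=> w _; rewrite lee_fin.
rewrite setDE setCK setTI ge0_integral_bigsetU//=; last 2 first.
- exact: measurable_funTS.
- by move=> w _; rewrite lee_fin.
apply: eq_bigr => x _.
rewrite (eq_integral (cst (f x)%:E)); first by rewrite integral_cst.
by move=> w; rewrite inE /F/= => ->.
Qed.

Lemma mmt_gen_fun_finite_support (R : realType) (d : measure_display)
    (T : measurableType d) (P : probability T R) (X : {RV P >-> R})
    (s : seq R) (w : R -> R) (beta : R) :
  uniq s -> (forall x, x \in s -> P (X @^-1` [set x]) = (w x)%:E) ->
  \sum_(x <- s) w x = 1 ->
  'M_P X beta = (\sum_(x <- s) w x * expR (beta * x))%:E.
Proof.
move=> us Pw w1; rewrite /mmt_gen_fun.
rewrite (@expectation_finite_support _ _ _ _ X s (expR \o *%R^~ beta))//.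
- rewrite -sumEFin !big_seq; apply: eq_bigr => x xs.
  by rewrite Pw//= -EFinM mulrC (mulrC x).
- by apply: measurableT_comp => //; exact: mulrr_measurable.
- by move=> x; exact: expR_ge0.
- by rewrite -w1 -sumEFin !big_seq; apply: eq_bigr => x xs; rewrite Pw.
Qed.

(** * Maximizers in the Legendre transform of a logarithmic exponential sum *)

Lemma legendre_eq_max (R : realType) (f : R -> \bar R) (g : R -> R)
    (alpha beta0 : R) :
  (forall beta, f beta = (g beta)%:E) ->
  (forall beta, alpha * beta - g beta <= alpha * beta0 - g beta0) ->
  legendre f alpha = (alpha * beta0 - g beta0)%:E.
Proof.
move=> fg gmax; apply/eqP; rewrite eq_le; apply/andP; split.
  by apply: ge_ereal_sup => _ [beta _ <-]; rewrite fg -EFinB lee_fin.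
by apply: ereal_sup_ubound; exists beta0 => //; rewrite fg.
Qed.

(** The hypothesis says that the law tilted by [beta0], with weights
    proportional to [w x * expR (beta0 * x)], has mean [alpha].  The tangent line
    bound [1 + u <= expR u] at [u = (beta - beta0) * (x - alpha)], averaged
    over the tilted law, loses its linear term, which leaves
    [Z beta0 * expR ((beta - beta0) * alpha) <= Z beta] for the exponential
    sum [Z]. *)
Lemma exp_sum_tilt_max (R : realType) (s : seq R) (w : R -> R)
    (alpha beta0 beta : R) :
  let Z b := \sum_(x <- s) w x * expR (b * x) in
  (forall x, 0 <= w x) -> 0 < Z beta0 ->
  \sum_(x <- s) w x * expR (beta0 * x) * x = alpha * Z beta0 ->
  alpha * beta - ln (Z beta) <= alpha * beta0 - ln (Z beta0).
Proof.
move=> Z w0 Z0 mean.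
have centered : \sum_(x <- s) w x * expR (beta0 * x) * (x - alpha) = 0.
  under eq_bigr do rewrite mulrBr.
  by rewrite sumrB mean -mulr_suml -/(Z beta0) mulrC subrr.
have ZE : expR ((beta - beta0) * alpha) * Z beta0 <= Z beta.
  rewrite (_ : expR _ * Z beta0 = \sum_(x <- s) w x * expR (beta0 * x) *
      (expR ((beta - beta0) * alpha) * (1 + (beta - beta0) * (x - alpha)))).
    apply: ler_sum => x _.
    have -> : beta * x = beta0 * x + ((beta - beta0) * alpha +
        (beta - beta0) * (x - alpha)) by ring.
    rewrite !expRD [leRHS]mulrA ler_wpM2l ?mulr_ge0 ?expR_ge0//.
    by rewrite ler_wpM2l ?expR_ge0// expR_ge1Dx.
  set e := expR ((beta - beta0) * alpha).
  rewrite (eq_bigr (fun x => e * (w x * expR (beta0 * x)) +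
      e * (beta - beta0) * (w x * expR (beta0 * x) * (x - alpha)))).
    by rewrite big_split/= -!mulr_sumr centered mulr0 addr0.
  by move=> x _; ring.
have Zb : 0 < Z beta by rewrite (lt_le_trans _ ZE)// mulr_gt0 ?expR_gt0.
have : ln (expR ((beta - beta0) * alpha) * Z beta0) <= ln (Z beta).
  by rewrite ler_ln// posrE mulr_gt0 ?expR_gt0.
by rewrite lnM ?posrE ?expR_gt0// expRK; lra.
Qed.

(** * The tilting parameter of the uniform law on three points *)

(** The discriminant of [(2 - alpha) * t ^+ 2 + (1 - alpha) * t - alpha]. *)
Definition tilt_disc (R : realType) (alpha : R) : R :=
  1 + 6 * alpha - 3 * alpha ^+ 2.

Definition tilt_root (R : realType) (alpha : R) : R :=
  ((alpha - 1) + Num.sqrt (tilt_disc alpha)) / (2 * (2 - alpha)).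

Lemma sqr_sqrt_tilt_disc (R : realType) (alpha : R) :
  0 < alpha -> alpha < 2 ->
  Num.sqrt (tilt_disc alpha) ^+ 2 = tilt_disc alpha.
Proof.
move=> a0 a2; rewrite sqr_sqrtr// /tilt_disc.
have a2' : 0 < 2 - alpha by lra.
by have := mulr_gt0 a0 a2'; lra.
Qed.

(** The product of the two roots of the quadratic is
    [- alpha / (2 - alpha) < 0], and [tilt_root] is the larger one. *)
Lemma tilt_root_gt0 (R : realType) (alpha : R) :
  0 < alpha -> alpha < 2 -> 0 < tilt_root alpha.
Proof.
move=> a0 a2; have a2' : 0 < 2 - alpha by lra.
rewrite /tilt_root divr_gt0//; last by lra.
have := sqr_sqrt_tilt_disc a0 a2; have := sqrtr_ge0 (tilt_disc alpha).
set r := Num.sqrt _; rewrite /tilt_disc => r0 r2.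
(* [r ^+ 2 - (1 - alpha) ^+ 2 = 4 * alpha * (2 - alpha) > 0]. *)
have r1 : `|1 - alpha| < r.
  rewrite -(ger0_norm r0) -ltr_sqr ?nnegrE// !real_normK ?num_real// r2.
  by have := mulr_gt0 a0 a2'; lra.
by have := ler_norm (1 - alpha); lra.
Qed.

Lemma tilt_root_quadratic (R : realType) (alpha : R) :
  0 < alpha -> alpha < 2 ->
  (2 - alpha) * tilt_root alpha ^+ 2 + (1 - alpha) * tilt_root alpha = alpha.
Proof.
move=> a0 a2; have a2' : 2 - alpha != 0 by rewrite gt_eqF//; lra.
have := sqr_sqrt_tilt_disc a0 a2; rewrite /tilt_root.
set r := Num.sqrt _ => r2; apply/eqP; rewrite -subr_eq0; apply/eqP.
transitivity ((r ^+ 2 - tilt_disc alpha) / (4 * (2 - alpha))).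
  by rewrite /tilt_disc; field.
by rewrite r2 subrr mul0r.
Qed.

(** The law on [0, 1, 2] with weights proportional to [1, t, t ^+ 2] has mean
    [alpha]. *)
Lemma tilt_root_mean (R : realType) (alpha : R) : let t := tilt_root alpha in
  0 < alpha -> alpha < 2 -> t + 2 * t ^+ 2 = alpha * (1 + t + t ^+ 2).
Proof.
by move=> t a0 a2; have := tilt_root_quadratic a0 a2; rewrite -/t; lra.
Qed.

Lemma tilt_root_partition (R : realType) (alpha : R) :
  let t := tilt_root alpha in 0 < alpha -> alpha < 2 ->
  1 + t + t ^+ 2 =
  ((7 - 3 * alpha) + Num.sqrt (tilt_disc alpha)) / (2 * (2 - alpha) ^+ 2).
Proof.
move=> t a0 a2; have a2' : 2 - alpha != 0 by rewrite gt_eqF//; lra.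
(* Eliminating [t ^+ 2] by the quadratic equation leaves a quantity that is
   affine in [t], hence in the square root. *)
transitivity ((2 + t) / (2 - alpha)).
  apply: (mulIf a2'); rewrite divfK//.
  by have := tilt_root_quadratic a0 a2; rewrite -/t; lra.
by rewrite /t /tilt_root; field.
Qed.

Theorem mainTheorem1 (R : realType) (d : measure_display)
    (T : measurableType d) (P0 : probability T R) (sigma1 : {RV P0 >-> R})
    (sigma1_uniform : forall k : nat, (k < 3)%N ->
       P0 [set w | sigma1 w = k%:R] = (1 / 3)%:E)
    (alpha : R) (alpha_gt0 : 0 < alpha) (alpha_lt2 : alpha < 2) :
  mogulskii_lagrangian sigma1 alpha =
  (ln 3
   + alpha * ln (((alpha - 1) + Num.sqrt (1 + 6 * alpha - 3 * alpha ^+ 2))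
                 / (2 * (2 - alpha)))
   - ln (((7 - 3 * alpha) + Num.sqrt (1 + 6 * alpha - 3 * alpha ^+ 2))
         / (2 * (2 - alpha) ^+ 2)))%:E.
Proof.
pose s : seq R := [:: 0; 1; 2]; pose w (_ : R) : R := 1 / 3.
pose Z b := \sum_(x <- s) w x * expR (b * x).
set t := (X in alpha * ln X); set Q := (X in _ - ln X).
have t0 : 0 < t by exact: tilt_root_gt0.
have expR_ln : expR (ln t) = t by rewrite lnK.
have expR_ln2 : expR (ln t * 2) = t ^+ 2 by rewrite expRM_natr expR_ln.
have tQ : 1 + t + t ^+ 2 = Q by exact: tilt_root_partition.
have mean_t : t + 2 * t ^+ 2 = alpha * (1 + t + t ^+ 2).
  exact: tilt_root_mean.
(* As opaque atoms, [t] and [Q] keep [ln_div] and [lra] out of the explicit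
   quotients that they stand for. *)
clearbody t Q.
have Q0 : 0 < Q by rewrite -tQ; nra.
have Z_t : Z (ln t) = Q / 3.
  rewrite /Z /s /w !big_cons big_nil mulr0 mulr1 expR0 expR_ln expR_ln2 -tQ.
  by field.
have mgf b : 'M_P0 sigma1 b = (Z b)%:E.
  apply: mmt_gen_fun_finite_support.
  - by rewrite /= !inE !negb_or; apply/and3P; split => //; lra.
  - move=> x; rewrite !inE => /or3P[] /eqP ->.
    + exact: (sigma1_uniform 0).
    + exact: (sigma1_uniform 1).
    + exact: (sigma1_uniform 2).
  - by rewrite /s /w !big_cons big_nil; field.
have Zb0 b : 0 < Z b.
  rewrite /Z /s /w !big_cons big_nil.
  by have := expR_gt0 (b * 0); have := expR_gt0 (b * 1);
    have := expR_gt0 (b * 2); lra.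
rewrite /mogulskii_lagrangian
  (@legendre_eq_max _ _ (fun b => ln (Z b)) _ (ln t)).
- by rewrite Z_t ln_div ?posrE//; congr EFin; lra.
- by move=> b; rewrite /log_mgf mgf lne_EFin.
- move=> b; apply: exp_sum_tilt_max; rewrite -/(Z _)//.
    by move=> x; rewrite divr_ge0.
  rewrite Z_t -tQ /s /w !big_cons big_nil !mulr0 !mulr1 expR_ln expR_ln2.
  lra.
Qed.
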